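(* Let $T$ be a real-valued functional on the space $\mathcal{P}(\mathbb{R})$ of probability measures on $\mathbb{R}$, let $p\in\mathcal{P}(\mathbb{R})$, and let $\epsilon_n$ denote the empirical distribution of $n$ independent identically distributed samples from $p$. Let $v_{jack}$ and $v_{ijack}$ denote the jackknife and infinitesimal jackknife estimates of the variance of $T(\epsilon_n)$. Let $\|q'-q\|$ denote the supremum of the absolute value of the difference between the cumulative distribution functions of $q'$ and $q$. Suppose that there exist positive constants $C$, $\delta$ and $h$ such that $$T(q')=T(q)+\partial T_q(q'-q)+\mathcal{R}(q',q)$$ for all $q',q$ with $\|q'-p\|<\delta$ and $\|q-p\|<\delta$, where $\partial T_q$ is the functional derivative of $T$ at $q$ and the remainder satisfies $|\mathcal{R}(q',q)|\le C\|q'-q\|^{1+h}$. Then, as $n\to\infty$, $$v_{jack}-v_{ijack}=\mathrm{O}_{\mathrm{p}}\big(n^{-h}\big)$$ if $v_{ijack}$ is bounded in probability.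
   Context: For samples $x_1,\ldots,x_n$ ($n\ge2$), let $\epsilon_n=\frac1n\sum_{i=1}^n\delta(x_i)$ and $\epsilon_{ni}=\frac{1}{n-1}\sum_{j\ne i}\delta(x_j)$, where $\delta(x)$ is the point mass at $x$ (the constant $\delta$ in the claim is a separate object). The jackknife pseudovalues are $Q_{ni}=nT(\epsilon_n)-(n-1)T(\epsilon_{ni})$. With $\overline{Q_n}=\frac1n\sum_{j=1}^n Q_{nj}$, the jackknife variance estimator is $$v_{jack}=\frac{1}{n-1}\sum_{i=1}^n\big(Q_{ni}-\overline{Q_n}\big)^2.$$ The functional derivative $\partial T_q$ is a continuous linear functional on the space $\mathcal{M}(\mathbb{R})$ of bounded signed measures on $\mathbb{R}$, where $\mathcal{M}(\mathbb{R})$ carries the norm $\|m\|=\sup_{t\in\mathbb{R}}|m((-\infty,t])|$. The influence function of $T$ at $q$ is $\phi_q(x)=\partial T_q(\delta(x)-q)$. The infinitesimal jackknife variance estimator is $$v_{ijack}=\mathbb{E}_{\epsilon_n}\phi_{\epsilon_n}^2=\frac1n\sum_{i=1}^n\phi_{\epsilon_n}(x_i)^2.$$ A sequence $X_n$ of random variables is bounded in probability if for every $\eta>0$ there exist $M,N$ with $\Pr(|X_n|>M)<\eta$ for all $n\ge N$. The notation $X_n=\mathrm{O}_{\mathrm{p}}(n^{-h})$ means that $n^hX_n$ is bounded in probability.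
   Formalization: The rate proved is O_p(n^{-min(h,1)}), which is the stated O_p(n^{-h}) when h ≤ 1; for h > 1 the stated rate fails, e.g. for T(q)=q((-∞,0]) with 0<p((-∞,0])<1, where the difference equals v_ijack/(n-1). *)

(* Defs.v *)
(* MathComp-Analysis, over an arbitrary [R : realType]. *)
From HB Require Import structures.
From mathcomp Require Import all_boot all_order all_algebra.
From mathcomp Require Import finmap.
From mathcomp Require Import all_classical all_reals all_analysis.

Set Implicit Arguments.
Unset Strict Implicit.
Unset Printing Implicit Defensive.

Import Order.TTheory GRing.Theory Num.Theory.
Import numFieldNormedType.Exports.

Local Open Scope classical_set_scope.
Local Open Scope ring_scope.

Section Measures.
Context {R : realType}.

(* Charges are finite on measurable sets, hence bounded: these are the bounded
   signed Borel measures on the line. *)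
Definition smeas := {charge set (measurableTypeR R) -> \bar R}.
Definition pmeas := probability (measurableTypeR R) R.

Definition sadd (m1 m2 : smeas) : smeas := cadd m1 m2.
Definition sscale (a : R) (m : smeas) : smeas := cscale a m.
Definition ssub (m1 m2 : smeas) : smeas := cadd m1 (copp m2).
Definition pdiff (q' q : pmeas) : smeas :=
  ssub (charge_of_finite_measure q') (charge_of_finite_measure q).

(* The supremum is a genuine one, see [has_sup_snorm] below. *)
Definition snorm (m : smeas) : R :=
  sup [set `|fine (m `]-oo, t]%classic)| | t in [set: R]].

Lemma has_sup_snorm (m : smeas) :
  has_sup [set `|fine (m `]-oo, t]%classic)| | t in [set: R]].
Proof.
split; first by exists `|fine (m `]-oo, 0]%classic)|, 0.
have [P [N mPN]] := Hahn_decomposition m.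
exists (fine (charge_variation mPN [set: R])) => _ [t _ <-].
have fV A : measurable A -> charge_variation mPN A \is a fin_num.
  by move=> mA; exact: fin_num_measure.
have mt : measurable (`]-oo, t]%classic : set (measurableTypeR R)).
  exact: measurable_itv.
rewrite -lee_fin fineK; last exact: fV.
have := fin_num_measure m _ mt => mfin.
rewrite -abse_EFin fineK//.
apply: (le_trans (abse_charge_variation mPN mt)).
by rewrite le_measure// ?inE//; exact: measurableT.
Qed.

Definition linear_functional (L : smeas -> R) : Prop :=
  forall (a : R) (m1 m2 : smeas),
    L (sadd (sscale a m1) m2) = a * L m1 + L m2.

Definition continuous_functional (L : smeas -> R) : Prop :=
  forall (m : smeas) (e : R), 0 < e ->
    exists2 d : R, 0 < d &
      forall m' : smeas, snorm (ssub m' m) < d -> `|L m' - L m| < e.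

(* Frechet derivative of [T] at [q], along probability measures. *)
Definition functional_derivative (T : pmeas -> R) (q : pmeas)
    (L : smeas -> R) : Prop :=
  [/\ linear_functional L, continuous_functional L &
      forall e : R, 0 < e ->
        exists2 d : R, 0 < d &
          forall q' : pmeas, snorm (pdiff q' q) < d ->
            `|T q' - T q - L (pdiff q' q)| <= e * snorm (pdiff q' q)].

Definition point_mass (x : R) : pmeas := \d_(x : measurableTypeR R).

(* Mean of the point masses at the entries of [s]; [mnormalize] divides the sum
   of the point masses by its total mass [size s].  The empty sample is sent to
   the irrelevant value [\d_0]. *)
Definition empirical (s : seq R) : pmeas :=
  mnormalize (msum (fun k => point_mass s`_k) (size s)) (point_mass 0).

Lemma empiricalE (s : seq R) (A : set R) : (0 < size s)%N ->
  empirical s A = ((size s)%:R^-1 * \sum_(x <- s) \1_A x)%:E.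
Proof.
move=> s0; have szE B : msum (fun k => point_mass s`_k) (size s) B =
    (\sum_(x <- s) \1_B x)%:E.
  rewrite /msum (big_nth 0) big_mkord -sumEFin; apply: eq_bigr => k _.
  by rewrite /point_mass/= diracE indicE.
have szT : \sum_(x <- s) \1_[set: R] x = (size s)%:R :> R.
  rewrite (eq_bigr (fun=> 1)); last by move=> x _; rewrite indicE in_setT.
  by rewrite big_const_seq count_predT iter_addr_0.
rewrite /empirical/= /mnormalize/= szE szT eqe pnatr_eq0 -leqn0 leqNgt s0/=.
rewrite szE.
by rewrite -EFinM mulrC.
Qed.

(* Samples are numbered from 0: the first [n] ones are [x 0, ..., x n.-1]. *)
Definition eps (x : nat -> R) (n : nat) : pmeas :=
  empirical [seq x j | j <- iota 0 n].

Definition eps_loo (x : nat -> R) (n i : nat) : pmeas :=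
  empirical [seq x j | j <- iota 0 n & j != i].

Definition pseudovalue (T : pmeas -> R) (x : nat -> R) (n i : nat) : R :=
  n%:R * T (eps x n) - n.-1%:R * T (eps_loo x n i).

Definition pseudomean (T : pmeas -> R) (x : nat -> R) (n : nat) : R :=
  n%:R^-1 * \sum_(j < n) pseudovalue T x n j.

Definition v_jack (T : pmeas -> R) (x : nat -> R) (n : nat) : R :=
  n.-1%:R^-1 * \sum_(i < n) (pseudovalue T x n i - pseudomean T x n) ^+ 2.

(* [dT q] stands for the functional derivative at [q]. *)
Definition influence (dT : pmeas -> smeas -> R) (q : pmeas) (x : R) : R :=
  dT q (pdiff (point_mass x) q).

Definition v_ijack (dT : pmeas -> smeas -> R) (x : nat -> R) (n : nat) : R :=
  n%:R^-1 * \sum_(i < n) influence dT (eps x n) (x i) ^+ 2.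

End Measures.
Arguments smeas R : clear implicits.
Arguments pmeas R : clear implicits.

Section Probability.
Context d (Omega : measurableType d) (R : realType) (P : probability Omega R).

Definition mutually_independent (X : nat -> {RV P >-> measurableTypeR R}) :=
  forall (J : {fset nat}) (A : nat -> set (measurableTypeR R)),
    (forall i, measurable (A i)) ->
    P (\bigcap_(i in [set` J]) (X i @^-1` A i)) =
      (\prod_(i <- J) P (X i @^-1` A i))%E.

Definition iid (X : nat -> {RV P >-> measurableTypeR R}) (p : pmeas R) :=
  mutually_independent X /\
  forall i (A : set (measurableTypeR R)), measurable A ->
    distribution P (X i) A = p A.

(* The outer measure [P^*] agrees with [P] on events; it is used because the
   statistics of an arbitrary functional need not be measurable. *)
Definition bounded_in_probability (Z : nat -> Omega -> R) :=
  forall eta : R, 0 < eta ->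
    exists (M : R) (N : nat), forall n, (N <= n)%N ->
      ((P^*)%mu [set w | M < `|Z n w|]%R < eta%:E)%E.

(* [Z n = O_p(n^(-r))]. *)
Definition bigOp (Z : nat -> Omega -> R) (r : R) :=
  bounded_in_probability (fun n w => n%:R `^ r * Z n w).

End Probability.

(* Main.v *)
Require Import Defs.
From HB Require Import structures.
From mathcomp Require Import all_boot all_order all_algebra.
From mathcomp Require Import finmap.
From mathcomp Require Import all_classical all_reals all_analysis.
From mathcomp Require Import measurable_realfun ring lra.

Import Order.TTheory GRing.Theory Num.Theory.
Import numFieldNormedType.Exports.

Local Open Scope classical_set_scope.
Local Open Scope ring_scope.

(** Write [q] for the empirical distribution of the first [n] samples and [q_i]
for the one with sample [i] deleted. Since

  q_i - q = - (point_mass x_i - q) / (n - 1),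

the point [q_i] lies within [1 / (n - 1)] of [q], and expanding [T q_i] at [q]
shows that the [i]-th pseudovalue is [T q + phi_i - r_i], where [phi_i] is the
influence of [x_i] and [r_i = (n - 1) * Rem q_i q] is at most
[C * (n - 1)^(-h)] in absolute value. The influences sum to [0], because the
measures [point_mass x_i - q] do and the derivative is linear. The jackknife
estimate is thus [1 / (n - 1)] times the sum of the squares of the
[phi_i - (r_i - rbar)], where [rbar] is the mean of the [r_i], and the
infinitesimal one is [1 / n] times the sum of the squares of the [phi_i].
Replacing [1 / (n - 1)] by [1 / n] costs
[v_ijack / (n - 1)], and the cross terms and squares of the [r_i - rbar] cost
[O (n^(-h) * (1 + v_ijack))]: this is [v_jack_sub_v_ijack_le], whose two errors
are the reason for the exponent [Num.min h 1].

The expansion is available only when [q] and all the [q_i] are within [delta] of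
[p]. For large [n] this follows from [q] being within [delta / 2] of [p], an event
whose probability tends to [1] by [glivenko_cantelli]. On the intersection of
this event with the one on which [v_ijack] is at most [M], the inequality above
bounds [n^(min h 1) * (v_jack - v_ijack)] by a constant depending only on [C],
[h] and [M]. *)

(** * The norm on signed measures and continuous linear functionals *)

Definition ray_mass {R : realType} (m : set (measurableTypeR R) -> \bar R) (t : R) : R :=
  fine (m `]-oo, t]%classic).

Lemma ray_mass_sadd {R : realType} (m1 m2 : smeas R) t :
  ray_mass (sadd m1 m2) t = ray_mass m1 t + ray_mass m2 t.
Proof. by rewrite /ray_mass /sadd/= /cadd/= fineD// fin_num_measure. Qed.

Lemma ray_mass_sscale {R : realType} a (m : smeas R) t :
  ray_mass (sscale a m) t = a * ray_mass m t.
Proof. by rewrite /ray_mass /sscale/= /cscale/= fineM// fin_num_measure. Qed.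

Lemma ray_mass_ssub {R : realType} (m1 m2 : smeas R) t :
  ray_mass (ssub m1 m2) t = ray_mass m1 t - ray_mass m2 t.
Proof.
by rewrite /ray_mass /ssub/= /cadd/= /copp/= fineB// ?fin_num_measure.
Qed.

Lemma ray_mass_pdiff {R : realType} (q' q : pmeas R) t :
  ray_mass (pdiff q' q) t = ray_mass q' t - ray_mass q t.
Proof. exact: ray_mass_ssub. Qed.

Lemma snorm_le {R : realType} (m : smeas R) (c : R) :
  (forall t, `|ray_mass m t| <= c) -> snorm m <= c.
Proof.
move=> mc; apply: ge_sup; first exact: (has_sup_snorm m).1.
by move=> _ [t _ <-]; exact: mc.
Qed.

Lemma ray_mass_le_snorm {R : realType} (m : smeas R) t : `|ray_mass m t| <= snorm m.
Proof. by apply: sup_upper_bound; [exact: has_sup_snorm|exists t]. Qed.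

Lemma snorm_ge0 {R : realType} (m : smeas R) : 0 <= snorm m.
Proof. exact: le_trans (normr_ge0 _) (ray_mass_le_snorm m 0). Qed.

Lemma snorm_pdiff_triangle {R : realType} (q1 q2 q3 : pmeas R) :
  snorm (pdiff q1 q3) <= snorm (pdiff q1 q2) + snorm (pdiff q2 q3).
Proof.
apply: snorm_le => t; rewrite ray_mass_pdiff -(subrKA (ray_mass q2 t)).
by rewrite (le_trans (ler_normD _ _))// -!ray_mass_pdiff lerD// ray_mass_le_snorm.
Qed.

(** The norm sees a measure only through its masses on left rays, so it is a
priori a seminorm on charges; continuity of [L] nevertheless makes [L] depend on
these masses alone. Identities between charges need therefore only be checked on
rays, here and below. *)
Lemma functional_ext {R : realType} (L : smeas R -> R) (m1 m2 : smeas R) :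
  continuous_functional L -> ray_mass m1 =1 ray_mass m2 -> L m1 = L m2.
Proof.
move=> Lc m12; apply/eqP; rewrite -subr_eq0 -normr_eq0; apply/eqP.
apply/le_anti; rewrite normr_ge0 andbT; apply/ler_addgt0Pl => e e0.
rewrite addr0; have [d d0 Ld] := Lc m2 e e0; apply/ltW/Ld.
apply: le_lt_trans d0; apply: snorm_le => t.
by rewrite ray_mass_ssub m12 subrr normr0.
Qed.

Section functionals.
Context {R : realType} {L : smeas R -> R}.
Hypotheses (Ll : linear_functional L) (Lc : continuous_functional L).

Lemma functional_null (m : smeas R) : ray_mass m =1 (fun=> 0) -> L m = 0.
Proof.
move=> m0; have := Ll 1 m m; rewrite (functional_ext _ _ m Lc) => [|t].
  by lra.
by rewrite ray_mass_sadd ray_mass_sscale m0; lra.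
Qed.

Lemma functionalZ a (m m' : smeas R) : ray_mass m' =1 (fun t => a * ray_mass m t) ->
  L m' = a * L m.
Proof.
move=> mE; have z0 : L (sscale 0 m) = 0.
  by apply: functional_null => t; rewrite ray_mass_sscale mul0r.
rewrite -[RHS]addr0 -z0 -Ll; apply: functional_ext => // t.
by rewrite mE ray_mass_sadd !ray_mass_sscale; lra.
Qed.

Lemma functional_sum n (m : nat -> smeas R) :
  (forall t, \sum_(i < n) ray_mass (m i) t = 0) -> \sum_(i < n) L (m i) = 0.
Proof.
move=> m0.
(* [M] is the sum of the [m i], the empty sum being a null multiple of [m 0]. *)
have [M ML Mh] : exists2 M : smeas R, L M = \sum_(i < n) L (m i) &
    forall t, ray_mass M t = \sum_(i < n) ray_mass (m i) t.
  elim: n {m0} => [|n [M ML Mh]].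
    have z t : ray_mass (sscale 0 (m 0)) t = 0 by rewrite ray_mass_sscale mul0r.
    exists (sscale 0 (m 0)) => [|t]; last by rewrite big_ord0 z.
    by rewrite big_ord0; exact: functional_null.
  exists (sadd (sscale 1 M) (m n)); first by rewrite Ll ML mul1r big_ord_recr.
  by move=> t; rewrite ray_mass_sadd ray_mass_sscale Mh mul1r big_ord_recr.
by rewrite -ML; apply: functional_null => t; rewrite Mh m0.
Qed.

End functionals.

Lemma ray_mass01 {R : realType} (q : pmeas R) t : 0 <= ray_mass q t <= 1.
Proof.
have mt : measurable (`]-oo, t]%classic : set (measurableTypeR R)) by exact: measurable_itv.
rewrite /ray_mass fine_ge0//= -lee_fin fineK ?probability_le1//.
exact: fin_num_measure.
Qed.

(** * Empirical distributions and their leave-one-out versions *)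

Lemma sum_iota {R : realType} n (Q : pred nat) (F : nat -> R) :
  \sum_(j <- iota 0 n | Q j) F j = \sum_(j < n | Q j) F j.
Proof. by rewrite -(big_mkord Q) /index_iota subn0. Qed.

Lemma fine_eps {R : realType} (x : nat -> R) n (A : set R) : (0 < n)%N ->
  fine (eps x n A) = n%:R^-1 * \sum_(j < n) \1_A (x j).
Proof.
move=> n0; rewrite /eps empiricalE size_map size_iota//=.
by rewrite big_map sum_iota.
Qed.

Lemma ray_mass_eps {R : realType} (x : nat -> R) n t : (0 < n)%N ->
  ray_mass (eps x n) t = n%:R^-1 * \sum_(j < n) ray_mass (point_mass (x j)) t.
Proof. by move=> n0; rewrite /ray_mass fine_eps. Qed.

Lemma ray_mass_eps_loo {R : realType} (x : nat -> R) n (i : 'I_n) t : (1 < n)%N ->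
  ray_mass (eps_loo x n i) t =
  n.-1%:R^-1 * (\sum_(j < n) ray_mass (point_mass (x j)) t
                 - ray_mass (point_mass (x i)) t).
Proof.
move=> n1; have sz : size [seq x j | j <- iota 0 n & j != i :> nat] = n.-1.
  case: i => i /= ilt; rewrite size_map size_filter.
  have := count_predC (pred1 i) (iota 0 n).
  rewrite size_iota count_uniq_mem ?iota_uniq// mem_iota/= add0n ilt.
  by move=> cE; rewrite -[in RHS]cE add1n.
rewrite /ray_mass /eps_loo empiricalE sz ?(ltn_predRL 0)//; congr (_ * _).
rewrite big_map big_filter sum_iota.
rewrite [in RHS](bigD1 i)//= addrAC subrr add0r.
by apply: eq_bigl.
Qed.

(** Because [(n - 1) * eps_loo = n * eps - point_mass (x i)] on rays. Being an exact
multiple, the difference makes the first-order term of the expansion at [eps] a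
multiple of the influence of [x i]. *)
Lemma ray_mass_loo_sub {R : realType} (x : nat -> R) n (i : 'I_n) t : (1 < n)%N ->
  ray_mass (pdiff (eps_loo x n i) (eps x n)) t =
  - n.-1%:R^-1 * ray_mass (pdiff (point_mass (x i)) (eps x n)) t.
Proof.
move=> n1; rewrite !ray_mass_pdiff ray_mass_eps_loo// ray_mass_eps ?(ltnW n1)//.
have n0 : n.-1%:R != 0 :> R by rewrite pnatr_eq0 -lt0n ltn_predRL.
have nE : n%:R = n.-1%:R + 1 :> R by rewrite natr1 prednK// ltnW.
have := n0; have : n%:R != 0 :> R by rewrite pnatr_eq0 -lt0n ltnW.
rewrite nE => ? ?; field.
by apply/andP.
Qed.

Lemma snorm_loo_le {R : realType} (x : nat -> R) n (i : 'I_n) : (1 < n)%N ->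
  snorm (pdiff (eps_loo x n i) (eps x n)) <= n.-1%:R^-1.
Proof.
move=> n1; apply: snorm_le => t; rewrite ray_mass_loo_sub// normrM normrN.
rewrite normfV normr_nat ler_piMr ?invr_ge0 ?ler0n//.
rewrite ray_mass_pdiff; have := ray_mass01 (point_mass (x i)) t.
have := ray_mass01 (eps x n) t => /andP[? ?] /andP[? ?].
by rewrite ler_norml; apply/andP; split; lra.
Qed.

(** * The jackknife of perturbed influences *)

(** Centring removes [c] and turns [r i] into [r i - rbar], of size at most
[2 * rho]. Each cross term [2 * phi i * (rbar - r i)] is then controlled by
[2 * rho * (1 + phi i ^+ 2)], whose mean is [2 * rho * (1 + V)]. The factor
[n / (n - 1)] between the two normalisations is at most [2], which accounts for
the doubled constants and the term [2 / n * V]. *)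
Lemma jackknife_perturbation {R : realFieldType} n (c rho V : R)
    (phi r Q : 'I_n -> R) :
  (1 < n)%N -> \sum_(i < n) phi i = 0 -> (forall i, `|r i| <= rho) ->
  (forall i, Q i = c + phi i - r i) -> V = n%:R^-1 * \sum_(i < n) phi i ^+ 2 ->
  `|n.-1%:R^-1 * \sum_(i < n) (Q i - n%:R^-1 * \sum_(j < n) Q j) ^+ 2 - V|
    <= 2 / n%:R * V + 4 * rho * (1 + V) + 8 * rho ^+ 2.
Proof.
move=> n1 phi0 rrho QE VE.
have N0 : 0 < n%:R :> R by rewrite ltr0n ltnW.
have NE : n%:R = n.-1%:R + 1 :> R by rewrite natr1 prednK// ltnW.
have N1 : 1 <= n.-1%:R :> R by rewrite ler1n ltn_predRL.
pose rbar := n%:R^-1 * \sum_(j < n) r j.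
have sumr (F : 'I_n -> R) b : (forall i, `|F i| <= b) ->
    `|\sum_(i < n) F i| <= n%:R * b.
  move=> Fb; apply: le_trans (ler_norm_sum _ _ _) _.
  apply: le_trans (ler_sum _ (fun i _ => Fb i)) _.
  by rewrite sumr_const card_ord mulr_natl.
have rbar_le : `|rbar| <= rho.
  by rewrite normrM normfV normr_nat ler_pdivrMl// sumr.
have QbarE : n%:R^-1 * \sum_(j < n) Q j = c - rbar.
  rewrite (eq_bigr _ (fun i _ => QE i)) sumrB big_split/= phi0 addr0.
  by rewrite sumr_const card_ord -[c *+ n]mulr_natl mulrBr mulKf// gt_eqF.
rewrite QbarE; set S := \sum_(i < n) _ ^+ 2.
have V0 : 0 <= V by rewrite VE mulr_ge0 ?invr_ge0 ?ler0n// sumr_ge0// => *; exact: sqr_ge0.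
have rho0 : 0 <= rho by exact: le_trans (normr_ge0 _) rbar_le.
pose B := 2 * rho * (1 + V) + 4 * rho ^+ 2.
have SE : `|S - n%:R * V| <= n%:R * B.
  rewrite VE mulVKf ?gt_eqF// /S -sumrB.
  apply: le_trans (ler_norm_sum _ _ _) _.
  apply: (@le_trans _ _
      (\sum_(i < n) (2 * rho * (1 + phi i ^+ 2) + 4 * rho ^+ 2))).
    apply: ler_sum => i _; rewrite QE.
    have -> : (c + phi i - r i - (c - rbar)) ^+ 2 - phi i ^+ 2 =
      (2 * phi i) * (rbar - r i) + (rbar - r i) ^+ 2 by ring.
    have u2 : `|rbar - r i| <= 2 * rho.
      by rewrite (le_trans (ler_normB _ _))// mulr_natl lerD.
    have phi2 : `|2 * phi i| <= 1 + phi i ^+ 2.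
      have := sqr_ge0 (phi i - 1); have := sqr_ge0 (phi i + 1).
      by rewrite ler_norml => ? ?; apply/andP; split; nra.
    rewrite (le_trans (ler_normD _ _))// lerD//.
      by rewrite normrM mulrC ler_pM.
    have -> : 4 * rho ^+ 2 = (2 * rho) ^+ 2 by ring.
    by rewrite normrX lerXn2r// nnegrE ?mulr_ge0.
  rewrite big_split/= -mulr_sumr big_split/= !sumr_const card_ord.
  rewrite -[4 * _ *+ n]mulr_natl /B VE le_eqVlt; apply/orP; left.
  apply/eqP; field; exact: lt0r_neq0.
have -> : n.-1%:R^-1 * S - V = n.-1%:R^-1 * (V + (S - n%:R * V)).
  by rewrite NE; field; rewrite gt_eqF// (lt_le_trans _ N1).
rewrite normrM normfV normr_nat ler_pdivrMl; last exact: lt_le_trans N1.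
apply: (@le_trans _ _ (V + n%:R * B)).
  by rewrite (le_trans (ler_normD _ _))// lerD// ger0_norm.
have -> : 2 / n%:R * V + 4 * rho * (1 + V) + 8 * rho ^+ 2 =
  2 / n%:R * (V + n%:R * B) by rewrite /B; field; exact: lt0r_neq0.
have B0 : 0 <= B by rewrite /B addr_ge0 ?mulr_ge0 ?sqr_ge0 ?addr_ge0.
have VB0 : 0 <= V + n%:R * B by rewrite addr_ge0// mulr_ge0// ltW.
rewrite mulrA ler_peMl//.
by rewrite mulrA ler_pdivlMr// mul1r; lra.
Qed.

Lemma sum_influence {R : realType} (dT : pmeas R -> smeas R -> R)
    (x : nat -> R) n : (0 < n)%N ->
  linear_functional (dT (eps x n)) -> continuous_functional (dT (eps x n)) ->
  \sum_(i < n) influence dT (eps x n) (x i) = 0.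
Proof.
move=> n0 Ll Lc.
apply: (functional_sum Ll Lc n (fun i => pdiff (point_mass (x i)) (eps x n))) => t.
under eq_bigr do rewrite ray_mass_pdiff ray_mass_eps//.
rewrite sumrB sumr_const card_ord -[X in _ - X]mulr_natl mulVKf ?subrr//.
by rewrite pnatr_eq0 -lt0n.
Qed.

(** With [e = n^(- min h 1)], both [1 / n] and [n^(-h)] are at most [e <= 1].
Hence each of the three terms of [jackknife_perturbation], applied with
[rho = C * (n - 1)^(-h) <= C * (2 / n)^h <= D * e] where [D = C * 2^h], is at
most [e] times the corresponding term of the bound below. *)
Lemma v_jack_sub_v_ijack_le {R : realType} (T : pmeas R -> R)
    (dT : pmeas R -> smeas R -> R) (Rem : pmeas R -> pmeas R -> R)
    (C h : R) (x : nat -> R) n :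
  0 < C -> 0 < h -> (1 < n)%N ->
  linear_functional (dT (eps x n)) -> continuous_functional (dT (eps x n)) ->
  (forall i : 'I_n, T (eps_loo x n i) = T (eps x n)
     + dT (eps x n) (pdiff (eps_loo x n i) (eps x n))
     + Rem (eps_loo x n i) (eps x n)) ->
  (forall i : 'I_n, `|Rem (eps_loo x n i) (eps x n)| <=
     C * snorm (pdiff (eps_loo x n i) (eps x n)) `^ (1 + h)) ->
  n%:R `^ Num.min h 1 * `|v_jack T x n - v_ijack dT x n| <=
  2 * v_ijack dT x n + 4 * (C * 2 `^ h) * (1 + v_ijack dT x n)
    + 8 * (C * 2 `^ h) ^+ 2.
Proof.
move=> C0 h0 n1 Ll Lc Texp Rle.
set q := eps x n; set V := v_ijack dT x n; set D := C * 2 `^ h.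
pose rho := C * n.-1%:R^-1 `^ h.
have N0 : 0 < n%:R :> R by rewrite ltr0n ltnW.
have NE : n%:R = n.-1%:R + 1 :> R by rewrite natr1 prednK// ltnW.
have N1 : 1 <= n.-1%:R :> R by rewrite ler1n ltn_predRL.
have N10 : 0 < n.-1%:R :> R by exact: lt_le_trans N1.
have jack : `|v_jack T x n - V| <= 2 / n%:R * V + 4 * rho * (1 + V) + 8 * rho ^+ 2.
  apply: (@jackknife_perturbation _ n (T q) rho V
    (fun i => influence dT q (x i))
    (fun i => n.-1%:R * Rem (eps_loo x n i) q)) => //.
  - by apply: sum_influence => //; exact: ltnW.
  - move=> i; rewrite normrM normr_nat.
    have : `|Rem (eps_loo x n i) q| <= C * (n.-1%:R^-1 * n.-1%:R^-1 `^ h).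
      apply: le_trans (Rle i) _; rewrite ler_pM2l//.
      rewrite -[X in X * _]powRr1 ?invr_ge0 ?ler0n//.
      rewrite -powRD; last by rewrite gt_eqF ?addr_gt0.
      by apply: ge0_ler_powR; rewrite ?nnegrE ?snorm_ge0 ?invr_ge0 ?ler0n ?snorm_loo_le ?addr_ge0 ?ltW.
    by rewrite mulrCA ler_pdivlMl.
  - move=> i; rewrite /pseudovalue Texp -/q.
    rewrite (functionalZ Ll Lc (- n.-1%:R^-1) (pdiff (point_mass (x i)) q)); last first.
      by move=> t; exact: ray_mass_loo_sub.
    rewrite -/(influence dT q (x i)) NE; field; exact: lt0r_neq0.
pose e := n%:R^-1 `^ Num.min h 1.
have e0 : 0 <= e by exact: powR_ge0.
have invN1 : (0 < n%:R^-1 :> R) && (n%:R^-1 <= 1 :> R) by rewrite invr_gt0 N0 invf_le1// ler1n ltnW.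
have neE : n%:R `^ Num.min h 1 * e = 1.
  by rewrite -powRM ?invr_ge0 ?ler0n// divff ?powR1// lt0r_neq0.
have e1 : e <= 1.
  by rewrite -(powRr0 n%:R^-1) ger_powR// le_min ler01 ltW.
have inv_e : n%:R^-1 <= e.
  by rewrite -[leLHS]powRr1 ?invr_ge0 ?ler0n// ger_powR// ge_min lexx orbT.
have D0 : 0 < D by rewrite mulr_gt0// powR_gt0.
have rho_le : rho <= D * e.
  rewrite -mulrA ler_pM2l//.
  apply: (@le_trans _ _ (2 `^ h * n%:R^-1 `^ h)); last first.
    by rewrite ler_pM2l ?powR_gt0// ger_powR// ge_min lexx.
  rewrite -powRM ?invr_ge0 ?ler0n//.
  apply: ge0_ler_powR; rewrite ?nnegrE ?invr_ge0 ?mulr_ge0 ?invr_ge0 ?ler0n ?(ltW h0)//.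
  by rewrite ler_pdivlMr// ler_pdivrMl//; lra.
have rho0 : 0 <= rho by rewrite mulr_ge0 ?powR_ge0 ?ltW.
have V0 : 0 <= V.
  by rewrite /V mulr_ge0 ?invr_ge0 ?ler0n// sumr_ge0// => *; exact: sqr_ge0.
have -> : 2 * V + 4 * D * (1 + V) + 8 * D ^+ 2 = n%:R `^ Num.min h 1 *
    (2 * e * V + 4 * (D * e) * (1 + V) + 8 * (D ^+ 2 * e)).
  transitivity ((n%:R `^ Num.min h 1 * e) *
    (2 * V + 4 * D * (1 + V) + 8 * D ^+ 2)); last by ring.
  by rewrite neE mul1r.
apply: ler_wpM2l; first exact: powR_ge0.
apply: le_trans jack _; apply: lerD; first apply: lerD.
- by rewrite ler_wpM2r// ler_pM2l.
- by rewrite ler_wpM2r ?addr_ge0// ler_pM2l.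
- rewrite ler_pM2l//; apply: (@le_trans _ _ ((D * e) ^+ 2)).
    by rewrite lerXn2r// nnegrE// mulr_ge0// ltW.
  by rewrite exprMn ler_pM2l ?exprn_gt0// expr2 ler_piMr.
Qed.

(** * Uniform closeness of distribution functions from finitely many rays *)

Lemma ray_mass_le {R : realType} (q : pmeas R) s t : s <= t -> ray_mass q s <= ray_mass q t.
Proof.
move=> st; rewrite /ray_mass fine_le ?fin_num_measure// le_measure ?inE//.
exact: subset_itvl.
Qed.

Section ray_mass_limits.
Context {R : realType} (q : pmeas R).

(* [q] is the law of the identity, whose cumulative distribution function is
   [ray_mass q]. *)
Let idTR : measurableTypeR R -> R := idfun.

#[local] HB.instance Definition _ :=
  @isMeasurableFun.Build _ _ _ _ idTR (@measurable_id _ _ setT).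

Let ray_massE : ray_mass q = fine \o cdf (idTR : {RV q >-> R}).
Proof. by []. Qed.

Lemma ray_mass_cvgy : ray_mass q t @[t --> +oo] --> (1 : R).
Proof. rewrite ray_massE; apply: fine_cvg; exact: cvg_cdfy1. Qed.

Lemma ray_mass_cvgNy : ray_mass q t @[t --> -oo] --> (0 : R).
Proof. rewrite ray_massE; apply: fine_cvg; exact: cvg_cdfNy0. Qed.

Lemma ray_mass_right_continuous t : ray_mass q s @[s --> t^'+] --> ray_mass q t.
Proof.
rewrite ray_massE; apply: fine_cvg; rewrite /= fineK ?fin_num_measure//.
exact: cdf_right_continuous.
Qed.

End ray_mass_limits.

(** The [c]-quantile, characterised by the Galois connection between it and the
distribution function. Right continuity is what makes the infimum of
[[set s | c <= ray_mass q s]] belong to this set. *)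
Lemma quantile_ex {R : realType} (q : pmeas R) (c : R) : 0 < c < 1 ->
  exists t, forall s, (c <= ray_mass q s) = (t <= s).
Proof.
move=> /andP[c0 c1]; pose E := [set s | c <= ray_mass q s].
have [s Es] : E !=set0.
  by have [s /ltW] := filter_ex (cvgr_gt _ (ray_mass_cvgy q) _ c1); exists s.
have [M [_ ltM]] := cvgr_lt _ (ray_mass_cvgNy q) _ c0.
have Einf : has_inf E.
  split; first by exists s.
  exists (M - 1) => r Er; rewrite leNgt; apply/negP => rM.
  have rM' : r < M by apply: lt_trans rM _; rewrite ltrBlDr ltrDl.
  by have := ltM r rM'; rewrite /= ltNge Er.
exists (inf E) => r; apply/idP/idP => [Er|tr].
  by apply: ge_inf => //; exact: Einf.2.
apply: le_trans (ray_mass_le q _ _ tr); rewrite leNgt; apply/negP => lt_c.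
have := cvgr_lt _ (ray_mass_right_continuous q (inf E)) _ lt_c.
move=> [/= e e0 He].
have [u Eu ue] := inf_adherent e0 Einf.
have : inf E <= u by apply: ge_inf => //; exact: Einf.2.
rewrite le_eqVlt => /orP[/eqP uE|uE].
  by move: lt_c; rewrite uE ltNge Eu.
have := He u; rewrite /= distrC ger0_norm ?subr_ge0 ?ltW// ltrBlDl.
by move=> /(_ ue uE); rewrite ltNge Eu.
Qed.

Lemma open_ray_le {R : realType} (q : pmeas R) (c t : R) :
  (forall s, s < t -> ray_mass q s <= c) -> fine (q `]-oo, t[%classic) <= c.
Proof.
move=> qc; pose F n : set R := `]-oo, (t - n.+1%:R^-1)]%classic.
have FE : `]-oo, t[%classic = \bigcup_n F n.
  apply/seteqP; split=> r /=; rewrite in_itv/=.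
    by move=> /ltr_add_invr[n rn]; exists n; rewrite // /F/= in_itv/= lerBrDr ltW.
  by case=> n _; rewrite /F/= ?in_itv/= => /le_lt_trans; apply; rewrite ltrBlDr ltrDl.
have : (q \o F) n @[n --> \oo] --> q (\bigcup_n F n).
  apply: nondecreasing_cvg_mu.
  - by move=> i; exact: measurable_itv.
  - by apply: bigcup_measurable => i _; exact: measurable_itv.
  - move=> m n mn; apply/subsetPset; apply: subset_itvl.
    by rewrite bnd_simp lerD2l lerN2 lef_pV2 ?posrE// ler_nat.
rewrite -FE => qF; rewrite -lee_fin fineK; last first.
  by rewrite fin_num_measure//; exact: measurable_itv.
apply: cvge_to_le qF _; near=> n.
rewrite /= -[leLHS]fineK ?lee_fin; first by apply: qc; rewrite ltrBlDr ltrDl.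
by rewrite fin_num_measure//; exact: measurable_itv.
Unshelve. all: by end_near. Qed.

(** With [t j] the quantile of order [j / k] for [0 < j < k], a ray ending at [s]
lies between two rays ending at consecutive [t j], or the empty set or the whole
line at the extremes, whose [p]-masses are within [1 / k] of that of the given
ray. As [p] may have atoms, the larger ray has to be the open one, for only this
one is sure to have mass at most [j / k]; hence the closed and open rays, selected
by the boolean [b] in [BSide b]. *)
Lemma finite_control {R : realType} (p : pmeas R) k : (0 < k)%N ->
  exists t : nat -> R, forall (q : pmeas R) e,
    (forall j b, (j < k)%N ->
      `|fine (q [set` Interval -oo%O (BSide b (t j))]) -
        fine (p [set` Interval -oo%O (BSide b (t j))])| <= e) ->
    snorm (pdiff q p) <= e + k%:R^-1.
Proof.
move=> k0; have k0' : 0 < k%:R :> R by rewrite ltr0n.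
have /choice [t tP] : forall j, exists t, (0 < j < k)%N ->
    forall s, (j%:R / k%:R <= ray_mass p s) = (t <= s).
  move=> j; have [jk|] := boolP (0 < j < k)%N; last by exists 0.
  have [|t tP] := quantile_ex p (j%:R / k%:R); last by exists t.
  by rewrite divr_gt0 ?ltr0n//= ?ltr_pdivrMr// ?mul1r ?ltr_nat; case/andP: jk.
exists t => q e qp.
have qpc j : (j < k)%N -> `|ray_mass q (t j) - ray_mass p (t j)| <= e.
  exact: qp j false.
have e0 : 0 <= e by exact: le_trans (normr_ge0 _) (qpc _ k0).
apply: snorm_le => s; rewrite ray_mass_pdiff ler_norml.
have /andP[p0 p1] := ray_mass01 p s; have /andP[q0 q1] := ray_mass01 q s.
have /truncn_itv/andP[] : 0 <= k%:R * ray_mass p s by rewrite mulr_ge0// ltW.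
set m := Num.truncn _ => mp pm.
have ki0 : 0 <= k%:R^-1 :> R by rewrite invr_ge0 ltW.
apply/andP; split; last first.
  have [mk|mk] := ltnP m.+1 k.
    have mS : (0 < m.+1 < k)%N by [].
    have st : s < t m.+1.
      by rewrite ltNge -tP// -ltNge ltr_pdivlMr// mulrC.
    have ps : fine (p `]-oo, t m.+1[%classic) <= m.+1%:R / k%:R.
      by apply: open_ray_le => r rt; rewrite ltW// ltNge tP// -ltNge.
    have : ray_mass q s <= fine (q `]-oo, t m.+1[%classic).
      rewrite fine_le ?fin_num_measure//; try exact: measurable_itv.
      by rewrite le_measure ?inE//; try exact: measurable_itv; exact: subset_itvl.
    have := qp m.+1 true mk; rewrite ler_norml => /andP[_ qpe].
    have : m.+1%:R / k%:R <= ray_mass p s + k%:R^-1.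
      by rewrite ler_pdivrMr// mulrDl mulVf ?lt0r_neq0// -natr1 lerD2r mulrC.
    by lra.
  have : 1 - k%:R^-1 <= ray_mass p s.
    rewrite -(ler_pM2l k0') mulrBr mulr1 divff ?lt0r_neq0//.
    by apply: le_trans mp; rewrite lerBlDr natr1 ler_nat.
  by lra.
(* When [ray_mass p s = 1], [m = k] is not the index of a quantile and [k.-1] is
   used in its place. *)
have [j [jk pj jp]] : exists j, [/\ (j < k)%N, ray_mass p s <= j.+1%:R / k%:R &
    j%:R / k%:R <= ray_mass p s].
  have [mk|km] := ltnP m k.
    exists m; split=> //; last by rewrite ler_pdivrMr// mulrC.
    by rewrite ler_pdivlMr// mulrC ltW.
  exists k.-1; split; first by rewrite prednK.
    by rewrite prednK// divff ?lt0r_neq0.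
  rewrite ler_pdivrMr// mulrC; apply: le_trans mp; rewrite ler_nat.
  exact: leq_trans (leq_pred k) km.
case: j => [|j] in jk pj jp *; first by lra.
have ts : t j.+1 <= s by rewrite -tP.
have := ray_mass_le q _ _ ts; have := qpc _ jk.
rewrite ler_norml => /andP[+ _].
have : j.+1%:R / k%:R <= ray_mass p (t j.+1) by rewrite tP.
by move: pj; rewrite -(natr1 j.+1) mulrDl mul1r; lra.
Qed.

(** * Empirical frequencies of pairwise independent events *)

Lemma iid_preimage {d} {Omega : measurableType d} {R : realType}
    {P : probability Omega R} {X : nat -> {RV P >-> measurableTypeR R}}
    {p : pmeas R} : iid X p ->
  forall i (A : set (measurableTypeR R)), measurable A ->
    P (X i @^-1` A) = (fine (p A))%:E.
Proof.
move=> [_ Xp] i A mA; rewrite fineK ?fin_num_measure//.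
exact: Xp.
Qed.

Lemma iid_preimageI {d} {Omega : measurableType d} {R : realType}
    {P : probability Omega R} {X : nat -> {RV P >-> measurableTypeR R}}
    {p : pmeas R} : iid X p ->
  forall (i j : nat) (A : set (measurableTypeR R)), i != j -> measurable A ->
    P (X i @^-1` A `&` X j @^-1` A) = (fine (p A) * fine (p A))%:E.
Proof.
move=> Xiid i j A ij mA.
have := Xiid.1 [fset i; j]%fset (fun=> A) (fun=> mA).
rewrite big_fsetU1 ?inE//= big_seq_fset1 !(iid_preimage Xiid)//.
rewrite -EFinM => <-; congr (P _); apply/seteqP; split=> w /=.
  by move=> [Xi Xj] k /=; rewrite !inE => /orP[] /eqP ->.
by move=> XA; split; apply: XA; rewrite /= !inE eqxx ?orbT.
Qed.

Section empirical_frequency.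
Context {d} {Omega : measurableType d} {R : realType} {P : probability Omega R}.
Variables (B : nat -> set Omega) (a : R).
Hypothesis mB : forall i, measurable (B i).
Hypothesis PB : forall i, P (B i) = a%:E.
Hypothesis PBI : forall i j : nat, i != j -> P (B i `&` B j) = (a * a)%:E.

Let S n w : R := \sum_(i < n) \1_(B i) w.

Let S_ge0 n w : 0 <= S n w. Proof. by apply: sumr_ge0 => i _; rewrite indicE. Qed.

Lemma measurable_frequency n : measurable_fun setT (S n).
Proof. by apply: measurable_sum => i; exact: measurable_indic. Qed.

Lemma integral_sum_indic (I : finType) (D : I -> set Omega) :
  (forall i, measurable (D i)) ->
  (\int[P]_w (\sum_i \1_(D i) w)%:E = \sum_i P (D i))%E.
Proof.
move=> mD; under eq_integral do rewrite -sumEFin.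
rewrite ge0_integral_sum//.
  by apply: eq_bigr => i _; rewrite integral_indic// setIT.
by move=> i; apply/measurable_EFinP; exact: measurable_indic.
Qed.

Let integral_S n : (\int[P]_w (S n w)%:E = (n%:R * a)%:E)%E.
Proof.
rewrite integral_sum_indic//; under eq_bigr do rewrite PB.
by rewrite sumEFin sumr_const card_ord mulr_natl.
Qed.

Let integral_S2 n : (\int[P]_w ((S n w) ^+ 2)%:E =
  (n%:R * a + n%:R * (n%:R - 1) * (a * a))%:E)%E.
Proof.
under eq_integral => w _.
  have -> : S n w ^+ 2 =
      \sum_(k : 'I_n * 'I_n) \1_(B k.1 `&` B k.2) w.
    rewrite expr2 /S mulr_suml -(pair_bigA _ (fun i j : 'I_n => \1_(B i `&` B j) w))/=.
    apply: eq_bigr => i _; rewrite mulr_sumr; apply: eq_bigr => j _.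
    by rewrite indicI.
  over.
rewrite integral_sum_indic; last by move=> k; exact: measurableI.
rewrite -(pair_bigA _ (fun i j : 'I_n => P (B i `&` B j)))/=.
transitivity (\sum_(i < n) (a + (n%:R - 1) * (a * a))%:E)%E.
  apply: eq_bigr => i _; rewrite (bigD1 i)//= setIid PB EFinD; congr (_ + _)%E.
  rewrite (eq_bigr (fun=> (a * a)%:E)); last first.
    by move=> j ji; rewrite PBI// eq_sym.
  rewrite sumEFin sumr_const cardC1 card_ord -[X in X%:E]mulr_natl.
  by case: n i => [[]//|n] i; rewrite -[n.+1%:R]natr1 addrK.
rewrite sumEFin sumr_const card_ord -[X in X%:E]mulr_natl mulrDr.
by rewrite mulrA.
Qed.

(** The variance of the sum of the indicators is [n * (a - a ^+ 2) <= n]. It is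
obtained by integrating [(S - n * a) ^+ 2 + 2 * n * a * S = S ^+ 2 + (n * a) ^+ 2],
both sides of which are sums of nonnegative functions. *)
Lemma frequency_chebyshev n (e : R) : 0 < e -> (0 < n)%N ->
  (P [set w | e <= `|n%:R^-1 * S n w - a|]%R <= ((n%:R * e ^+ 2)^-1)%:E)%E.
Proof.
move=> e0 n0; have n0' : 0 < n%:R :> R by rewrite ltr0n.
have a0 : 0 <= a by rewrite -lee_fin -(PB 0).
have mS := measurable_frequency n.
pose g w := (S n w - n%:R * a) ^+ 2.
have mg : measurable_fun setT g.
  by apply: measurable_funX; apply: measurable_funB.
have g0 w : 0 <= g w by exact: sqr_ge0.
have gE : (\int[P]_w (g w)%:E + (2 * n%:R * a)%:E * (n%:R * a)%:E =
    (n%:R * a + n%:R * (n%:R - 1) * (a * a))%:E + ((n%:R * a) ^+ 2)%:E)%E.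
  have mES : measurable_fun setT (EFin \o S n) by exact/measurable_EFinP.
  have k0 : (0 <= (2 * n%:R * a)%:E)%E by rewrite lee_fin !mulr_ge0.
  rewrite -integral_S2 -integral_S.
  rewrite -(ge0_integralZl _ measurableT mES)// => [|w _]; last first.
    by rewrite lee_fin S_ge0.
  rewrite -ge0_integralD//; first last.
  - by apply/measurable_EFinP; exact: measurable_funM.
  - by move=> w _; rewrite -EFinM lee_fin !mulr_ge0.
  - exact/measurable_EFinP.
  - by move=> w _; rewrite lee_fin.
  rewrite -[in RHS](mule1 ((n%:R * a) ^+ 2)%:E) -(probability_setT P) -integral_cst//.
  rewrite -ge0_integralD//; first last.
  - by move=> w _; rewrite lee_fin sqr_ge0.
  - by apply/measurable_EFinP; exact: measurable_funX.
  - by move=> w _; rewrite lee_fin sqr_ge0.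
  apply: eq_integral => w _; rewrite -EFinM -!EFinD; congr EFin.
  by rewrite /g; ring.
have gle : (\int[P]_w (g w)%:E <= n%:R%:E)%E.
  move: gE; case: (\int[P]_w (g w)%:E)%E => // r; rewrite -EFinM -!EFinD => -[gE].
  rewrite lee_fin (_ : r = n%:R * (a - a * a)); last by lra.
  by rewrite ler_piMr//; have := sqr_ge0 (a - 1); nra.
have g_dev w : g w = (n%:R * `|n%:R^-1 * S n w - a|) ^+ 2.
  rewrite exprMn real_normK ?num_real// /g; field; exact: lt0r_neq0.
have k0 : 0 < (n%:R * e) ^+ 2 by rewrite exprn_gt0// mulr_gt0.
have mgE : measurable_fun setT (EFin \o g) by exact/measurable_EFinP.
set D := [set w | _].
have PD : (((n%:R * e) ^+ 2)%:E * P D <= n%:R%:E)%E.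
  have := le_integral_abse P measurableT mgE k0.
  rewrite (_ : setT `&` _ = D); last first.
    rewrite setTI; apply/seteqP; split=> w /=; rewrite lee_fin (ger0_norm (g0 w)) g_dev;
      by rewrite ler_pXn2r// ?nnegrE ?mulr_ge0 ?ler_pM2l// ltW.
  under eq_integral => w _ do rewrite /= ger0_norm//.
  by move=> /le_trans; apply; exact: gle.
have P0 : (0 <= P D)%E by exact: measure_ge0.
move: PD P0; case: (P D) => [r||]//; last by rewrite gt0_muley ?lte_fin.
rewrite -EFinM !lee_fin => rn _.
rewrite -(ler_pM2l k0); apply: le_trans rn _.
by rewrite le_eqVlt; apply/orP; left; apply/eqP; field; rewrite !lt0r_neq0.
Qed.

End empirical_frequency.

(** * Convergence of the jackknife estimate *)

(** Convergence in outer probability: [snorm] of the difference is a supremum over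
uncountably many [t], but up to [e / 2] it is controlled by the [2 * k] rays of
[finite_control], to which Chebyshev's inequality applies. *)
Lemma glivenko_cantelli {d} {Omega : measurableType d} {R : realType}
    {P : probability Omega R} {X : nat -> {RV P >-> measurableTypeR R}}
    {p : pmeas R} (e eta : R) : iid X p -> 0 < e -> 0 < eta ->
  exists N, forall n, (N <= n)%N ->
    ((P^*)%mu [set w | e < snorm (pdiff (eps (fun i => X i w) n) p)]%R
      < eta%:E)%E.
Proof.
move=> Xiid e0 eta0.
have [k k0 ke] : exists2 k, (0 < k)%N & k%:R^-1 <= e / 2.
  have [k ke] : exists k, 0 + k.+1%:R^-1 < e / 2.
    by apply/ltr_add_invr; rewrite divr_gt0.
  by exists k.+1 => //; move: ke; rewrite add0r => /ltW.
have [t tP] := finite_control p k k0.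
(* The pair [(b, j)] is coded by the number [b + j.*2]. *)
pose A i : set (measurableTypeR R) :=
  [set` Interval -oo%O (BSide (odd i) (t i./2))].
have mA i : measurable (A i) by exact: measurable_itv.
pose c := (e / 2) ^+ 2.
have c0 : 0 < c by rewrite exprn_gt0// divr_gt0.
exists (Num.truncn (k.*2%:R / (c * eta))).+1 => n Nn.
have n0 : (0 < n)%N by exact: leq_trans Nn.
have n0' : 0 < n%:R :> R by rewrite ltr0n.
pose freq i w : R := n%:R^-1 * \sum_(j < n) \1_(X j @^-1` A i) w.
pose D i := [set w | e / 2 <= `|freq i w - fine (p (A i))|].
have mXA i j : measurable (X j @^-1` A i) by exact: measurable_funPTI.
have mD i : measurable (D i).
  have mf : measurable_fun setT (fun w => `|freq i w - fine (p (A i))|).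
    apply: measurableT_comp => //; apply: measurable_funB => //.
    by apply: measurable_funM => //; exact: (measurable_frequency (fun j => X j @^-1` A i)).
  have := mf measurableT _ (measurable_itv `[e / 2, +oo[).
  rewrite setTI; congr (measurable _); apply/seteqP.
  by split=> w /=; rewrite in_itv/= andbT.
have PD i : (P (D i) <= ((n%:R * c)^-1)%:E)%E.
  apply: (frequency_chebyshev (fun j => X j @^-1` A i)) => //; last by rewrite divr_gt0.
  - by move=> j; exact: iid_preimage.
  - by move=> j1 j2 j12; exact: iid_preimageI.
have sub : [set w | e < snorm (pdiff (eps (fun i => X i w) n) p)]
    `<=` \big[setU/set0]_(i < k.*2) D i.
  move=> w /= ew; apply: contrapT => notD.
  suff : snorm (pdiff (eps (fun i => X i w) n) p) <= e / 2 + k%:R^-1.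
    by move: ew ke; lra.
  apply: tP => j b jk; rewrite leNgt; apply/negP => dev; apply: notD.
  have ijk : (b + j.*2 < k.*2)%N.
    by apply: (@leq_trans j.+1.*2); [case: b {dev}|rewrite leq_double].
  rewrite -bigcup_mkord; exists (b + j.*2)%N => //.
  rewrite /D /freq /A/= half_bit_double oddD odd_double addbF oddb.
  by move: dev; rewrite fine_eps// => /ltW.
apply: le_lt_trans (le_mu_ext _ sub) _.
rewrite measurable_mu_extE; last exact: bigsetU_measurable.
apply: le_lt_trans (le_mu_bigsetU P (fun i _ => mD i)) _.
apply: (@le_lt_trans _ _ (\sum_(i < k.*2) ((n%:R * c)^-1)%:E)%E).
  by apply: lee_sum => i _; exact: PD.
rewrite sumEFin sumr_const card_ord lte_fin -[ltLHS]mulr_natl.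
rewrite ltr_pdivrMr ?mulr_gt0//.
have : k.*2%:R / (c * eta) < n%:R.
  by apply: lt_le_trans (truncnS_gt _) _; rewrite ler_nat.
by rewrite ltr_pdivrMr ?mulr_gt0// (_ : n%:R * (c * eta) = eta * (n%:R * c)) //; ring.
Qed.

Theorem proposition4p1 (R : realType) (d : measure_display)
    (Omega : measurableType d) (P : probability Omega R)
    (p : pmeas R) (X : nat -> {RV P >-> measurableTypeR R}) (HX : iid X p)
    (T : pmeas R -> R) (dT : pmeas R -> smeas R -> R)
    (Rem : pmeas R -> pmeas R -> R) (C delta h : R)
    (C_gt0 : 0 < C) (delta_gt0 : 0 < delta) (h_gt0 : 0 < h)
    (HdT : forall q : pmeas R, snorm (pdiff q p) < delta ->
       functional_derivative T q (dT q))
    (Hexp : forall q' q : pmeas R,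
       snorm (pdiff q' p) < delta -> snorm (pdiff q p) < delta ->
       T q' = T q + dT q (pdiff q' q) + Rem q' q)
    (HRem : forall q' q : pmeas R,
       snorm (pdiff q' p) < delta -> snorm (pdiff q p) < delta ->
       `|Rem q' q| <= C * snorm (pdiff q' q) `^ (1 + h)) :
  bounded_in_probability P (fun n w => v_ijack dT (fun i => X i w) n) ->
  bigOp P
    (fun n w => v_jack T (fun i => X i w) n - v_ijack dT (fun i => X i w) n)
    (Num.min h 1).
Proof.
move=> vbounded eta eta0.
have eta20 : 0 < eta / 2 by rewrite divr_gt0.
have delta20 : 0 < delta / 2 by rewrite divr_gt0.
have [M [N1 vM]] := vbounded _ eta20.
have [N2 GC] := glivenko_cantelli _ _ HX delta20 eta20.
pose N3 := (Num.truncn (delta / 2)^-1).+2.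
pose D := C * 2 `^ h.
exists (2 * M + 4 * D * (1 + M) + 8 * D ^+ 2), (maxn N3 (maxn N1 N2)) => n.
rewrite !geq_max => /and3P[N3n N1n N2n].
have n1 : (1 < n)%N by exact: leq_trans N3n.
have n1_delta : n.-1%:R^-1 < delta / 2.
  rewrite invf_plt ?posrE ?ltr0n ?ltn_predRL//.
  apply: lt_le_trans (truncnS_gt _) _; rewrite ler_nat -ltnS prednK//.
  exact: ltnW.
have D0 : 0 < D by rewrite mulr_gt0// powR_gt0.
set bad := [set w | _]%R.
have sub : bad `<=` [set w | M < `|v_ijack dT (fun i => X i w) n|] `|`
    [set w | delta / 2 < snorm (pdiff (eps (fun i => X i w) n) p)].
  move=> w; rewrite /bad/= => badw; apply: contrapT => /not_orP[/negP vw /negP qw].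
  move: badw vw qw; set x := fun i => X i w; rewrite -!leNgt => badw vw qw.
  have eps_near : snorm (pdiff (eps x n) p) < delta by lra.
  have loo_near i : snorm (pdiff (eps_loo x n (i : 'I_n)) p) < delta.
    have := snorm_pdiff_triangle (eps_loo x n i) (eps x n) p.
    by have := snorm_loo_le x n i n1; lra.
  have [Ll Lc _] := HdT _ eps_near.
  have := v_jack_sub_v_ijack_le T dT Rem C h x n C_gt0 h_gt0 n1 Ll Lc
    (fun i => Hexp _ _ (loo_near i) eps_near)
    (fun i => HRem _ _ (loo_near i) eps_near).
  have vM' : v_ijack dT x n <= M by exact: le_trans (ler_norm _) vw.
  move: badw; rewrite normrM ger0_norm ?powR_ge0// -/D; nra.
apply: le_lt_trans (le_mu_ext _ sub) _.
apply: le_lt_trans (outer_measureU2 _ _ _) _.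
rewrite [eta]splitr EFinD; apply: lteD; [exact: vM|exact: GC].
Qed.
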